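(* Let $a,b\in\mathbb{Z}$ with $a\le b$ and let $V:\llbracket a,b\rrbracket\to\mathbb{R}$ be convex. Let $\bar V:[a,b]\to\mathbb{R}$ be the continuous function that agrees with $V$ on $\llbracket a,b\rrbracket$ and is obtained by extending $V$ linearly on each sub-interval $[z-1,z]\subset[a,b]$, $z\in\mathbb{Z}$. Then the (discrete) degree of freedom of $e^{-V}$ equals the (continuous) degree of freedom of $e^{-\bar V}$.
   Context: For integers $a\le b$, $\llbracket a,b\rrbracket$ denotes the set of integers $z$ with $a\le z\le b$. A function $V:\llbracket a,b\rrbracket\to\mathbb{R}$ is convex if $V(z-1)-2V(z)+V(z+1)\ge 0$ for every integer $z$ with $a<z<b$; it is concave if $-V$ is convex. A function $f:\llbracket a,b\rrbracket\to[0,\infty)$ is log-concave on $\llbracket a,b\rrbracket$ if $\log f$ is concave; for positive $f$ this means $f(z)^2\ge f(z-1)f(z+1)$ for all integers $a<z<b$. Discrete degree of freedom: for $V$ convex on $\llbracket a,b\rrbracket$ with real values, the degree of freedom of $e^{-V}$ is the largest integer $k$ such that there exist $\alpha>0$ and linearly independent functions $W_1,\dots,W_k:\llbracket a,b\rrbracket\to\mathbb{R}$ such that for all $\epsilon_1,\dots,\epsilon_k\in[-\alpha,\alpha]$ the function $e^{-V}\bigl(1+\sum_{i=1}^k\epsilon_iW_i\bigr)$ is log-concave on $\llbracket a,b\rrbracket$. When $a=b$ the degree of freedom of $e^{-V}$ is $1$. Continuous degree of freedom: let $U:\mathbb{R}\to\mathbb{R}\cup\{+\infty\}$ be convex with domain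 $E=\{x:U(x)<+\infty\}$. The degree of freedom of $e^{-U}$ is the largest integer $k$ such that there exist $\alpha>0$ and linearly independent continuous functions $U_1,\dots,U_k$ defined on $E$ such that for all $\epsilon_1,\dots,\epsilon_k\in[-\alpha,\alpha]$ the function $e^{-U}\bigl(1+\sum_{i=1}^k\epsilon_iU_i\bigr)$ is log-concave (on $E$, and zero outside $E$). The function $\bar V$, which is convex on $[a,b]$, is regarded as a convex function on $\mathbb{R}$ with domain $E=[a,b]$ by setting it equal to $+\infty$ outside $[a,b]$. *)

(* Defs.v *)
From mathcomp Require Import all_boot all_order all_algebra.
From mathcomp Require Import all_classical all_reals all_analysis.
From mathcomp Require Import ring.
Import Order.TTheory GRing.Theory Num.Theory.
Import numFieldNormedType.Exports.

Set Implicit Arguments.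
Unset Strict Implicit.
Unset Printing Implicit Defensive.

Local Open Scope classical_set_scope.
Local Open Scope ring_scope.

(* Functions on a subset A (an integer interval, or the domain E of U) are
   total functions of which only the values on A are ever constrained. *)
Definition lin_indep_on (R : realType) (T : Type) (A : set T) (k : nat)
    (W : 'I_k -> T -> R) : Prop :=
  forall c : 'I_k -> R,
    (forall x, A x -> \sum_(i < k) c i * W i x = 0) -> forall i, c i = 0.

Definition largest (P : nat -> Prop) (k : nat) : Prop :=
  P k /\ forall j, P j -> (j <= k)%N.

Definition dconvex (R : realType) (a b : int) (V : int -> R) : Prop :=
  forall z : int, a < z < b -> 0 <= V (z - 1) - 2 * V z + V (z + 1).

(* log f takes values in [-oo, +oo[, so its concavity is expressed without
   subtraction.  The second clause says that {log f > -oo} has no gap, which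
   the local inequality alone does not give when f vanishes. *)
Definition dlog_concave (R : realType) (a b : int) (f : int -> R) : Prop :=
  [/\ forall z, a <= z <= b -> 0 <= f z,
      forall x y z : int, a <= x -> x <= z <= y -> y <= b ->
        0 < f x -> 0 < f y -> 0 < f z
    & forall z : int, a < z < b ->
        (lne (f (z - 1))%:E + lne (f (z + 1))%:E <= 2%:E * lne (f z)%:E)%E].

Definition ddof_family (R : realType) (a b : int) (V : int -> R) (k : nat)
    : Prop :=
  exists (alpha : R) (W : 'I_k -> int -> R),
    [/\ 0 < alpha,
        lin_indep_on [set z : int | a <= z <= b] W
      & forall e : 'I_k -> R, (forall i, - alpha <= e i <= alpha) ->
          dlog_concave a b
            (fun z => expR (- V z) * (1 + \sum_(i < k) e i * W i z))].

Definition is_ddof (R : realType) (a b : int) (V : int -> R) (k : nat)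
    : Prop :=
  largest (ddof_family a b V) k.

Definition econvex (R : realType) (U : R -> \bar R) : Prop :=
  forall (x y t : R), 0 <= t <= 1 ->
    (U (t * x + (1 - t) * y)%R <= t%:E * U x + (1 - t)%:E * U y)%E.

Definition log_concave (R : realType) (f : R -> R) : Prop :=
  (forall x, 0 <= f x) /\ econvex (fun x => - lne (f x)%:E)%E.

(* Since expeR -oo = 0, the perturbed function below is zero outside
   E = {U < +oo}, whatever the values of the W i there. *)
Definition cdof_family (R : realType) (U : R -> \bar R) (k : nat) : Prop :=
  let E := [set x : R | (U x < +oo)%E] in
  exists (alpha : R) (W : 'I_k -> R -> R),
    [/\ 0 < alpha,
        forall i, {within E, continuous (W i)},
        lin_indep_on E W
      & forall e : 'I_k -> R, (forall i, - alpha <= e i <= alpha) ->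
          log_concave
            (fun x => fine (expeR (- U x)%E) *
                      (1 + \sum_(i < k) e i * W i x))].

Definition is_cdof (R : realType) (U : R -> \bar R) (k : nat) : Prop :=
  largest (cdof_family U) k.

Definition pl_interp (R : realType) (V : int -> R) (x : R) : R :=
  let z := Num.floor x in
  (1 - (x - z%:~R)) * V z + (x - z%:~R) * V (z + 1).

(* The value V (b + 1) is irrelevant: at x = b its coefficient is 0. *)
Definition pl_ext (R : realType) (a b : int) (V : int -> R) (x : R) : \bar R :=
  if a%:~R <= x <= b%:~R then (pl_interp V x)%:E else +oo%E.

Lemma pl_interp_int (R : realType) (V : int -> R) (z : int) :
  pl_interp V z%:~R = V z.
Proof. by rewrite /pl_interp intrKfloor subrr subr0 mul1r mul0r addr0. Qed.

Lemma pl_interp_linear (R : realType) (V : int -> R) (z : int) (x : R) :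
  (z - 1)%:~R <= x <= z%:~R ->
  pl_interp V x = (z%:~R - x) * V (z - 1) + (x - (z - 1)%:~R) * V z.
Proof.
move=> /andP[zx]; rewrite le_eqVlt => /orP[/eqP ->|xz].
  by rewrite pl_interp_int rmorphB /=; ring.
have /eqP fx : Num.floor x == z - 1 by rewrite floor_eq zx subrK.
by rewrite /pl_interp fx subrK rmorphB /=; ring.
Qed.

(* Main.v *)
(* The two notions agree because they admit the same perturbations.
   Replacing all the e_i by a single e and expanding the logarithms to first
   order at e = 0, for both signs of e, shows that a perturbation W is affine
   wherever the potential is: between consecutive integers in the continuous
   case, and W (z - 1) - 2 W z + W (z + 1) = 0 at every z where the second
   difference of V vanishes in the discrete case.  Hence a continuous
   perturbation is the interpolation of its restriction to the integers.
   Conversely, interpolate a small combination w of discrete perturbations and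
   extend each piece of V and of w to an affine function on the whole [a, b].
   The functions v_z - ln (1 + w_z) so obtained are convex, and when the second
   difference of w is dominated by the one of V at every interior integer, the
   potential of the perturbed function is their maximum, hence convex. *)
Require Import Defs.
From mathcomp Require Import all_boot all_order all_algebra.
From mathcomp Require Import all_classical all_reals all_analysis.
From mathcomp Require Import ring lra zify.
Import Order.TTheory GRing.Theory Num.Theory.
Import numFieldNormedType.Exports.

Set Implicit Arguments.
Unset Strict Implicit.
Unset Printing Implicit Defensive.

Local Open Scope classical_set_scope.
Local Open Scope ring_scope.

(** * First-order expansion of the logarithm *)

Lemma first_order_eq0 (R : realFieldType) (alpha s c : R) : 0 < alpha ->
  (forall e, - alpha <= e <= alpha -> 0 <= e * s + e ^+ 2 * c) -> s = 0.
Proof.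
move=> alpha0 H; apply/eqP; apply/negPn/negP => s0.
have s_gt0 : 0 < `|s| by rewrite normr_gt0.
have c_ge0 : 0 <= `|c| by [].
(* This [e] makes [e * c] smaller than [|s|], so the inequalities at [e] and [- e] cannot both
   hold. *)
pose e := Num.min alpha (`|s| / (2 * (1 + `|c|))).
have e0 : 0 < e by rewrite lt_min alpha0 divr_gt0//; lra.
have ea : e <= alpha by rewrite ge_min lexx.
have es : e * (2 * (1 + `|c|)) <= `|s|.
  by rewrite -ler_pdivlMr ?ge_min ?lexx ?orbT//; lra.
have cc : c <= `|c| by exact: ler_norm.
have ec : e * c <= e * `|c| by rewrite ler_wpM2l// ltW.
have H1 : 0 <= e * (s + e * c).
  by have := H e ltac:(lra); rewrite mulrDr expr2 mulrA.
have H2 : 0 <= e * (- s + e * c).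
  have := H (- e) ltac:(lra).
  by rewrite sqrrN mulrDr expr2 mulrN mulNr mulrA.
move: H1 H2; rewrite !pmulr_rge0//.
by case: (ger0P s) es; nra.
Qed.

(** Apply [ln y <= y - 1] to the inverse of [1 + x]; what remains is [0 <= x ^+ 2 * (1 + 2 * x)]. *)
Lemma ln1D_ge (R : realType) (x : R) : - 2^-1 <= x ->
  x - 2 * x ^+ 2 <= ln (1 + x).
Proof.
move=> x2; have x1 : 0 < 1 + x by lra.
have -> : ln (1 + x) = - ln ((1 + x)^-1) by rewrite lnV// opprK.
have := @le_ln1Dx R ((1 + x)^-1 - 1).
rewrite subrKC => le_ln.
have {}le_ln : ln ((1 + x)^-1) <= (1 + x)^-1 - 1.
  by apply: le_ln; have : 0 < (1 + x)^-1; [rewrite invr_gt0 | lra].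
rewrite lerNr; apply: le_trans le_ln _.
rewrite -(ler_pM2r x1) mulrBl mulVf ?gt_eqF// expr2; nra.
Qed.

(** Squeezing each [ln (1 + x)] between [x - 2 * x ^+ 2] and [x] leaves
    [e * (m - (t * u + (1 - t) * v))] plus a multiple of [e ^+ 2], nonnegative for small [e] of both
    signs. *)
Lemma ln_first_order (R : realType) (alpha t u v m : R) :
  0 < alpha -> 0 <= t <= 1 ->
  (forall e, - alpha <= e <= alpha ->
    0 < 1 + e * u -> 0 < 1 + e * v -> 0 < 1 + e * m ->
    t * ln (1 + e * u) + (1 - t) * ln (1 + e * v) <= ln (1 + e * m)) ->
  m = t * u + (1 - t) * v.
Proof.
move=> alpha0 t01 H.
pose K : R := 1 + `|u| + `|v| + `|m|.
have u0 : 0 <= `|u| by [].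
have v0 : 0 <= `|v| by [].
have m0 : 0 <= `|m| by [].
have K0 : 0 < 2 * K by rewrite /K; lra.
(* For [|e| <= B] the products of [e] with [u], [v] and [m] have absolute value at most 1/2, the
   range of [ln1D_ge]. *)
pose B := Num.min alpha (2 * K)^-1.
have B0 : 0 < B by rewrite lt_min alpha0 invr_gt0.
have Ba : B <= alpha by rewrite ge_min lexx.
have BK : B * (2 * K) <= 1 by rewrite -ler_pdivlMr// mul1r ge_min lexx orbT.
apply/eqP; rewrite -subr_eq0; apply/eqP.
apply: (@first_order_eq0 _ B _ (2 * (t * u ^+ 2 + (1 - t) * v ^+ 2)) B0).
move=> e eB.
have small w : `|w| <= K -> - 2^-1 <= e * w.
  move=> wK; have eB' : `|e| <= B by rewrite ler_norml.
  have : `|e * w| <= B * K by rewrite normrM ler_pM.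
  by rewrite ler_norml => /andP[]; lra.
have su : - 2^-1 <= e * u by apply: small; rewrite /K; lra.
have sv : - 2^-1 <= e * v by apply: small; rewrite /K; lra.
have sm : - 2^-1 <= e * m by apply: small; rewrite /K; lra.
have {}H : t * ln (1 + e * u) + (1 - t) * ln (1 + e * v) <= ln (1 + e * m).
  by apply: H; lra.
have Hu : t * (e * u - 2 * (e * u) ^+ 2) <= t * ln (1 + e * u).
  by rewrite ler_wpM2l ?ln1D_ge//; lra.
have Hv : (1 - t) * (e * v - 2 * (e * v) ^+ 2) <= (1 - t) * ln (1 + e * v).
  by rewrite ler_wpM2l ?ln1D_ge//; lra.
have Hm : ln (1 + e * m) <= e * m by apply: le_ln1Dx; lra.
move: H Hu Hv Hm.
move: (ln _) (ln _) (ln _) => A C D; lra.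
Qed.

Lemma log_concave_ln (R : realType) (f : R -> R) (x y t : R) :
  log_concave f -> 0 <= t <= 1 -> 0 < f x -> 0 < f y ->
  0 < f (t * x + (1 - t) * y) /\
  t * ln (f x) + (1 - t) * ln (f y) <= ln (f (t * x + (1 - t) * y)).
Proof.
move=> [f0 fc] t01 fx fy; have := fc x y t t01.
rewrite /= (lt_geF fx) (lt_geF fy).
have [fm|fm] := leP (f (t * x + (1 - t) * y)) 0; first by rewrite /= leye_eq.
by rewrite -!EFinN -!EFinM -EFinD lee_fin; split=> //; lra.
Qed.

Lemma log_concave_on_segment (R : realType) (a b : R) (u g : R -> R) :
  (forall x, a <= x <= b -> 0 < g x) ->
  (forall x y t, a <= x <= b -> a <= y <= b -> 0 <= t <= 1 ->
    u (t * x + (1 - t) * y) - ln (g (t * x + (1 - t) * y)) <=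
    t * (u x - ln (g x)) + (1 - t) * (u y - ln (g y))) ->
  log_concave (fun x =>
    fine (expeR (- (if (a <= x <= b)%R then (u x)%:E else +oo))%E) * g x).
Proof.
move=> g0 H; set f := (X in log_concave X).
have fin x : a <= x <= b -> (- lne (f x)%:E)%E = (u x - ln (g x))%:E.
  move=> xab; rewrite /f xab /= lt_geF ?mulr_gt0 ?expR_gt0 ?g0//.
  by rewrite lnM ?posrE ?expR_gt0 ?g0// expRK -EFinN; congr EFin; lra.
have fout x : ~~ (a <= x <= b) -> (- lne (f x)%:E)%E = +oo%E.
  by move=> xab; rewrite /f (negbTE xab) /= mul0r lexx.
have fNy x : (- lne (f x)%:E)%E != -oo%E.
  by case: (boolP (a <= x <= b)) => [/fin|/fout] ->.
split=> [x|x y t t01].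
  rewrite /f; case: ifP => [xab|_] /=; last by rewrite mul0r.
  by rewrite mulr_ge0 ?expR_ge0// ltW// g0.
(* The weights 0 and 1 are split off because [0 * +oo = 0]: an endpoint outside the segment makes
   the right-hand side [+oo] only when its weight is positive. *)
have [->|t0] := eqVneq t 0.
  by rewrite mul0r add0r subr0 mul1r mul0e add0e mul1e.
have [->|t1] := eqVneq t 1.
  by rewrite subrr mul0r addr0 mul1r mul0e adde0 mul1e.
have tpos : 0 < t by lra.
have t1pos : 0 < 1 - t by lra.
have [xab|xab] := boolP (a <= x <= b); last first.
  rewrite (fout _ xab) gt0_muley ?lte_fin//.
  rewrite addye ?leey//.
  have [/fin->//|/fout->] := boolP (a <= y <= b).
  by rewrite gt0_muley ?lte_fin.
have [yab|yab] := boolP (a <= y <= b); last first.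
  by rewrite (fout _ yab) gt0_muley ?lte_fin// (fin x)// -EFinM addey ?leey.
have mab : a <= t * x + (1 - t) * y <= b by nra.
by rewrite !fin//; apply: H.
Qed.

(** * Affine pieces of the interpolation *)

(** The line through the graph points at [z] and [z + 1], taken at every real [x] so that distinct
    pieces can be compared at one point. *)
Definition piece (R : realType) (V : int -> R) (z : int) (x : R) : R :=
  (1 - (x - z%:~R)) * V z + (x - z%:~R) * V (z + 1).

Definition second_diff (R : realType) (V : int -> R) (z : int) : R :=
  V (z - 1) - 2 * V z + V (z + 1).

(* The index a is allowed even if a = b, so that [a, b] is always covered. *)
Definition piece_index (a b z : int) : bool :=
  (a <= z) && ((z < b) || (z == a)).

Lemma pl_interp_piece (R : realType) (V : int -> R) (z : int) (x : R) :
  z%:~R <= x <= (z + 1)%:~R -> pl_interp V x = piece V z x.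
Proof.
move=> zx; rewrite (@pl_interp_linear _ _ (z + 1)) addrK// /piece.
by rewrite rmorphD /=; ring.
Qed.

(** Neighbouring pieces meet at [z], and their slopes differ by the second difference there. *)
Lemma piece_pred (R : realType) (V : int -> R) (z : int) (x : R) :
  piece V z x = piece V (z - 1) x + second_diff V z * (x - z%:~R).
Proof. by rewrite /piece /second_diff subrK rmorphB /=; ring. Qed.

Lemma piece_comb (R : realType) (V : int -> R) (z : int) (t x y : R) :
  piece V z (t * x + (1 - t) * y) = t * piece V z x + (1 - t) * piece V z y.
Proof. by rewrite /piece; ring. Qed.

Lemma piece_indexP (R : realType) (a b : int) (x : R) : a <= b ->
  a%:~R <= x <= b%:~R ->
  exists2 z, piece_index a b z & z%:~R <= x <= (z + 1)%:~R.
Proof.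
move=> ab /andP[ax xb].
(* At [x = b] the floor would select the piece starting at [b], so the index is [b - 1], or [a] when
   [a = b]. *)
have [xlt|xge] := ltP x b%:~R; last first.
  have {xge xb ax} -> : x = b%:~R by apply/eqP; rewrite eq_le xb.
  have [->|ba] := eqVneq b a.
    by exists a; rewrite /piece_index ?lexx ?eqxx ?orbT// ler_int; lia.
  exists (b - 1); first by rewrite /piece_index; lia.
  by rewrite subrK lexx ler_int andbT; lia.
exists (Num.floor x); last by rewrite floor_le_tmp /= ltW// floorD1_gt.
rewrite /piece_index floor_ge_int_tmp ax /=.
by rewrite -(ltr_int R) (le_lt_trans _ xlt)// floor_le_tmp.
Qed.

(** Since [p] is at least 1/2, [q <= p + c / 2 <= p * (1 + c) <= p * expR c]. *)
Lemma ln_le_lnD (R : realType) (p q c : R) : 2^-1 <= p -> 0 < q -> 0 <= c ->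
  q - p <= c / 2 -> ln q <= ln p + c.
Proof.
move=> p2 q0 c0 qp; have p0 : 0 < p by lra.
have le1c : q <= p * expR c.
  apply: (@le_trans _ _ (p * (1 + c))); first by nra.
  by rewrite ler_pM2l// expR_ge1Dx.
apply: (@le_trans _ _ (ln (p * expR c))).
  by rewrite ler_ln// posrE mulr_gt0// expR_gt0.
by rewrite lnM ?posrE ?expR_gt0// expRK.
Qed.

Lemma ln_concave (R : realType) (t x y : R) : 0 <= t <= 1 -> 0 < x -> 0 < y ->
  t * ln x + (1 - t) * ln y <= ln (t * x + (1 - t) * y).
Proof.
move=> /andP[t0 t1] x0 y0.
by have := @concave_ln R (Itv01 t0 t1) x y x0 y0; rewrite !convRE.
Qed.

(** * Convexity of the perturbed potential *)

Section Pieces.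
Variables (R : realType) (a b : int) (v w : int -> R).
Hypothesis w_small : forall (z : int) (x : R), piece_index a b z ->
  a%:~R <= x <= b%:~R -> 2^-1 <= 1 + piece w z x.
Hypothesis w_curv : forall z : int, a < z < b ->
  2 * `|second_diff w z| <= second_diff v z.

Let h z x := piece v z x - ln (1 + piece w z x).

(** Passing from piece [z - 1] to piece [z] adds [D * (x - z)] to [v] and [d * (x - z)] to [w],
    where [D] and [d] are the second differences. As [2 * |d| <= D], [ln_le_lnD] with
    [c = D * |x - z|] shows that the change in [v] outweighs that of the logarithm. *)
Lemma potential_step (z : int) (x : R) : a < z < b -> a%:~R <= x <= b%:~R ->
  (z%:~R <= x -> h (z - 1) x <= h z x) /\
  (x <= z%:~R -> h z x <= h (z - 1) x).
Proof.
move=> zab xab.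
have p2 : 2^-1 <= 1 + piece w z x.
  by apply: w_small => //; rewrite /piece_index; lia.
have q2 : 2^-1 <= 1 + piece w (z - 1) x.
  by apply: w_small => //; rewrite /piece_index; lia.
have := w_curv zab.
rewrite /h (piece_pred v z) (piece_pred w z) in p2 *.
move: (second_diff v z) (second_diff w z) p2 q2 => D d p2 q2 dD.
have d1 : d <= `|d| by exact: ler_norm.
have d0 : 0 <= `|d| by [].
split=> zx.
- have s0 : 0 <= x - z%:~R by rewrite subr_ge0.
  have c0 : 0 <= D * (x - z%:~R) by rewrite mulr_ge0//; lra.
  have ds : d * (x - z%:~R) <= D / 2 * (x - z%:~R).
    by rewrite ler_wpM2r//; lra.
  have := @ln_le_lnD R _ (1 + (piece w (z - 1) x + d * (x - z%:~R))) _
    q2 ltac:(lra) c0 ltac:(lra).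
  by lra.
- have s0 : 0 <= z%:~R - x by rewrite subr_ge0.
  have c0 : 0 <= D * (z%:~R - x) by rewrite mulr_ge0//; lra.
  have ds : d * (z%:~R - x) <= D / 2 * (z%:~R - x).
    by rewrite ler_wpM2r//; lra.
  have := @ln_le_lnD R _ (1 + piece w (z - 1) x) _ p2 ltac:(lra) c0 ltac:(lra).
  by lra.
Qed.

Lemma potential_le_up (n : nat) (y : int) (x : R) : a <= y -> y + n%:Z < b ->
  (y + n%:Z)%:~R <= x <= b%:~R -> h y x <= h (y + n%:Z) x.
Proof.
elim: n => [|n IHn] ay ynb; first by rewrite addr0.
move=> /andP[yx xb].
have yn : (y + n%:Z)%:~R <= x by apply: le_trans yx; rewrite ler_int; lia.
apply: (le_trans (IHn ay _ _)); [lia | by rewrite yn |].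
have [+ _] := @potential_step (y + n.+1%:Z) x ltac:(lia)
  ltac:(by rewrite xb andbT (le_trans _ yn)// ler_int; lia).
by rewrite (_ : y + n.+1%:Z - 1 = y + n%:Z); [apply | lia].
Qed.

Lemma potential_le_down (n : nat) (z : int) (x : R) : a <= z -> z + n%:Z < b ->
  a%:~R <= x <= (z + 1)%:~R -> h (z + n%:Z) x <= h z x.
Proof.
elim: n => [|n IHn] az znb; first by rewrite addr0.
move=> /andP[ax xz].
have xn : x <= (z + n.+1%:Z)%:~R by apply: le_trans xz _; rewrite ler_int; lia.
apply: le_trans (IHn az _ _); [| lia | by rewrite ax].
have [_] := @potential_step (z + n.+1%:Z) x ltac:(lia)
  ltac:(by rewrite ax (le_trans xn)// ler_int; lia).
by rewrite (_ : z + n.+1%:Z - 1 = z + n%:Z); [apply | lia].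
Qed.

(** Moving the index from [y] towards [z] only crosses integers lying between piece [y] and [x], and
    each crossing can only raise [h] at [x]. *)
Lemma potential_max (y z : int) (x : R) : piece_index a b y ->
  piece_index a b z -> a%:~R <= x <= b%:~R -> z%:~R <= x <= (z + 1)%:~R ->
  h y x <= h z x.
Proof.
rewrite /piece_index => yab zab /andP[ax xb] /andP[zx xz].
have [yz|zy] := leP y z.
  have zE : z = y + `|z - y|%:Z by lia.
  (* Setting [z = y] apart excludes the degenerate index [z = a = b], so that [z < b] below. *)
  have [->//|zNy] := eqVneq z y.
  rewrite zE; apply: potential_le_up; [lia | lia |].
  by rewrite -zE zx.
have yE : y = z + `|y - z|%:Z by lia.
by rewrite yE; apply: potential_le_down; [lia | lia | rewrite ax].
Qed.

(** With [z] the piece containing the intermediate point, [h z] is convex, being affine minus the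
    logarithm of an affine function. It equals the potential there and is at most the potential at
    [x] and [y]. *)
Lemma pl_potential_convex (x y t : R) : a <= b ->
  a%:~R <= x <= b%:~R -> a%:~R <= y <= b%:~R -> 0 <= t <= 1 ->
  pl_interp v (t * x + (1 - t) * y) -
    ln (1 + pl_interp w (t * x + (1 - t) * y)) <=
  t * (pl_interp v x - ln (1 + pl_interp w x)) +
  (1 - t) * (pl_interp v y - ln (1 + pl_interp w y)).
Proof.
move=> ab xab yab t01; set m := _ * x + _.
have mab : a%:~R <= m <= b%:~R by rewrite /m; nra.
have [z zI zm] := piece_indexP ab mab.
have [z1 zI1 zx] := piece_indexP ab xab.
have [z2 zI2 zy] := piece_indexP ab yab.
rewrite !(pl_interp_piece _ zm) !(pl_interp_piece _ zx) !(pl_interp_piece _ zy).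
have Hx := potential_max zI zI1 xab zx.
have Hy := potential_max zI zI2 yab zy.
have px := w_small zI xab; have py := w_small zI yab.
apply: (@le_trans _ _ (t * h z x + (1 - t) * h z y)); last first.
  by rewrite lerD// ler_wpM2l//; lra.
rewrite /h !piece_comb.
have := @ln_concave R t (1 + piece w z x) (1 + piece w z y) t01
  ltac:(lra) ltac:(lra).
by rewrite (_ : t * (1 + piece w z x) + _ =
  1 + (t * piece w z x + (1 - t) * piece w z y)); [lra | ring].
Qed.
End Pieces.

(** * Choice of the perturbation size, and continuity of the interpolation *)

(** Each inequality holds for all small positive [d], and there are finitely many of them; indexing
    by ordinals lets the filter absorb the quantifier. *)
Lemma exists_small_factor (R : realType) (a b : int) (C D : int -> R) :
  (forall z, a <= z <= b -> 0 < D z \/ C z = 0 /\ 0 <= D z) ->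
  exists2 d, 0 < d & forall z, a <= z <= b -> d * C z <= D z.
Proof.
move=> CD; pose idx (n : 'I_`|b - a|.+1) : int := a + n%:Z.
suff : \forall d \near (0 : R)^'+, 0 < d /\
    forall n, a <= idx n <= b -> d * C (idx n) <= D (idx n).
  move=> /filter_ex [d [d0 dC]]; exists d => // z zab.
  have zn : (`|z - a| < `|b - a|.+1)%N by lia.
  have zE : z = idx (Ordinal zn) by rewrite /idx /=; lia.
  by rewrite zE in zab *; exact: dC.
apply: filter_app; last exact: (nbhs_right_gt (0 : R)).
have : \forall d \near (0 : R)^'+, forall n,
    a <= idx n <= b -> d * C (idx n) <= D (idx n).
  apply: filter_forall => n; move: (idx n) => z.
  have [/CD[Dz|[-> Dz]]|_] := boolP (a <= z <= b); last first.
  - by near=> d.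
  - by near=> d; rewrite mulr0.
  have C1 : 0 < 1 + `|C z| by rewrite ltr_wpDr.
  near=> d => _; have d0 : 0 < d by near: d; exact: nbhs_right_gt.
  have dD : d <= D z / (1 + `|C z|).
    by near: d; apply: nbhs_right_le; rewrite divr_gt0.
  rewrite ler_pdivlMr// in dD; apply: le_trans dD.
  by rewrite ler_pM2l// (le_trans (ler_norm _))// lerDr.
by apply: filterS => d dC d0; split.
Unshelve. all: by end_near.
Qed.

Lemma normr_sum_coef_le (R : realType) (k : nat) (d : R) (e y : 'I_k -> R) :
  (forall i, - d <= e i <= d) ->
  `|\sum_(i < k) e i * y i| <= d * \sum_(i < k) `|y i|.
Proof.
move=> ed; rewrite (le_trans (ler_norm_sum _ _ _))// mulr_sumr.
by apply: ler_sum => i _; rewrite normrM ler_wpM2r// ler_norml.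
Qed.

Lemma piece_sum (R : realType) (k : nat) (e : 'I_k -> R) (W : 'I_k -> int -> R)
    (z : int) (x : R) :
  piece (fun n => \sum_(i < k) e i * W i n) z x =
  \sum_(i < k) e i * piece (W i) z x.
Proof.
rewrite /piece !mulr_sumr -big_split /=.
by apply: eq_bigr => i _; ring.
Qed.

Lemma second_diff_sum (R : realType) (k : nat) (e : 'I_k -> R)
    (W : 'I_k -> int -> R) (z : int) :
  second_diff (fun n => \sum_(i < k) e i * W i n) z =
  \sum_(i < k) e i * second_diff (W i) z.
Proof.
rewrite /second_diff mulr_sumr -sumrB -big_split /=.
by apply: eq_bigr => i _; ring.
Qed.

Lemma piece_norm_le (R : realType) (a b : int) (V : int -> R) (z : int)
    (x : R) :
  a <= z <= b -> a%:~R <= x <= b%:~R ->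
  `|piece V z x| <= (1 + (b - a)%:~R) * (`|V z| + `|V (z + 1)|).
Proof.
move=> zab xab.
have [az zb] : a%:~R <= z%:~R :> R /\ z%:~R <= b%:~R :> R.
  by rewrite !ler_int; lia.
rewrite rmorphB /= (le_trans (ler_normD _ _))// !normrM mulrDr.
by rewrite lerD// ler_wpM2r// ler_norml; lra.
Qed.

Lemma pl_interp_continuous (R : realType) (V : int -> R) :
  continuous (pl_interp V).
Proof.
have pc z x : {for x, continuous (piece V z)}.
  by apply: differentiable_continuous; apply/derivable1_diffP; rewrite /piece.
move=> x; apply/left_right_continuousP; split.
(* The ceiling selects the piece to the left of [x] even when [x] is an integer, where the floor
   would give the piece to its right. *)
- set z := Num.ceil x - 1.
  have zx : z%:~R < x <= (z + 1)%:~R.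
    by rewrite subrK ceil_ge ceilB1_lt.
  rewrite (@pl_interp_piece _ _ z); last by lra.
  apply: cvg_trans (cvg_at_left_filter (pc z x)).
  apply: near_eq_cvg; near=> y; rewrite (@pl_interp_piece _ _ z)//.
  have yx : y <= x by near: y; exact: nbhs_left_le.
  have zy : z%:~R <= y by near: y; apply: nbhs_left_ge; lra.
  by rewrite zy /=; lra.
- set z := Num.floor x.
  have zx : z%:~R <= x < (z + 1)%:~R by rewrite floor_le_tmp floorD1_gt.
  rewrite (@pl_interp_piece _ _ z); last by lra.
  apply: cvg_trans (cvg_at_right_filter (pc z x)).
  apply: near_eq_cvg; near=> y; rewrite (@pl_interp_piece _ _ z)//.
  have yx : x <= y by near: y; exact: nbhs_right_ge.
  have zy : y <= (z + 1)%:~R by near: y; apply: nbhs_right_le; lra.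
  by rewrite zy andbT; lra.
Unshelve. all: by end_near.
Qed.

(** * From discrete to continuous perturbations *)

Lemma dlog_concave_ln (R : realType) (a b z : int) (f : int -> R) :
  dlog_concave a b f -> a < z < b -> 0 < f (z - 1) -> 0 < f z ->
  0 < f (z + 1) -> ln (f (z - 1)) + ln (f (z + 1)) <= 2 * ln (f z).
Proof.
move=> [_ _ fc] zab f1 f2 f3; have := fc z zab.
by rewrite !lne_EFin// -EFinM -EFinD lee_fin.
Qed.

Lemma dlog_concave_gt0 (R : realType) (a b : int) (f : int -> R) :
  (forall z, a <= z <= b -> 0 < f z) ->
  (forall z, a < z < b ->
    ln (f (z - 1)) + ln (f (z + 1)) <= 2 * ln (f z)) ->
  dlog_concave a b f.
Proof.
move=> f0 fc; split=> [z /f0/ltW//|x y z ax xzy yb _ _|z zab].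
  by apply: f0; lia.
rewrite !lne_EFin; [|apply: f0; lia..].
by rewrite -EFinM -EFinD lee_fin fc.
Qed.

Lemma ln_expRM (R : realType) (x y : R) : 0 < y ->
  ln (expR x * y) = x + ln y.
Proof. by move=> y0; rewrite lnM ?posrE ?expR_gt0// expRK. Qed.

Lemma sum_single (R : realType) (k : nat) (j : 'I_k) (e : R) (y : 'I_k -> R) :
  \sum_(i < k) (if i == j then e else 0) * y i = e * y j.
Proof.
rewrite (bigD1 j)//= eqxx big1 ?addr0// => i /negbTE ->.
by rewrite mul0r.
Qed.

Lemma single_bound (R : realType) (k : nat) (j i : 'I_k) (alpha e : R) :
  - alpha <= e <= alpha -> - alpha <= (if i == j then e else 0) <= alpha.
Proof. by case: ifP => // _ ?; lra. Qed.

(** Only the [j]-th coefficient is switched on. The vanishing second difference cancels the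
    exponential factors, leaving the situation of [ln_first_order] with weight 1/2. *)
Lemma ddof_second_diff0 (R : realType) (a b z : int) (V : int -> R)
    (k : nat) (alpha : R) (W : 'I_k -> int -> R) (j : 'I_k) :
  0 < alpha ->
  (forall e : 'I_k -> R, (forall i, - alpha <= e i <= alpha) ->
    dlog_concave a b
      (fun z => expR (- V z) * (1 + \sum_(i < k) e i * W i z))) ->
  a < z < b -> second_diff V z = 0 -> second_diff (W j) z = 0.
Proof.
move=> alpha0 H zab V0.
suff : W j z = 2^-1 * W j (z - 1) + (1 - 2^-1) * W j (z + 1).
  by rewrite /second_diff => ->; lra.
apply: (ln_first_order alpha0) => [|e eB u0 v0 m0]; first by lra.
have := dlog_concave_ln (H _ (fun i => single_bound j i eB)) zab.
rewrite !sum_single !ln_expRM// !mulr_gt0 ?expR_gt0//.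
by move=> /(_ isT isT isT); move: V0; rewrite /second_diff; lra.
Qed.

Lemma ddof_cdof (R : realType) (a b : int) (V : int -> R) (k : nat) :
  a <= b -> dconvex a b V -> ddof_family a b V k ->
  cdof_family (pl_ext a b V) k.
Proof.
move=> ab hV [alpha [W [alpha0 Wfree H]]].
pose curv z := \sum_(i < k) `|second_diff (W i) z|.
(* [d1] will give the curvature domination [w_curv]. Where [V] has zero second difference, all [W i]
   do too, so no smallness is required. *)
have [d1 d10 Hd1] : exists2 d, 0 < d & forall z, a + 1 <= z <= b - 1 ->
    d * (2 * curv z) <= second_diff V z.
  apply: exists_small_factor => z zab'; have zab : a < z < b by lia.
  have := hV z zab; rewrite -/(second_diff V z) le_eqVlt.
  move=> /orP[/eqP V0|]; last by left.
  right; split; last by rewrite -V0 eqxx.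
  rewrite /curv big1 ?mulr0// => i _.
  by rewrite (ddof_second_diff0 i alpha0 H zab)// normr0.
(* [size z] bounds the sum of the absolute values of the extended pieces on the whole of [a, b], so
   [d2] will give [w_small]. *)
pose size z := \sum_(i < k) (1 + (b - a)%:~R) * (`|W i z| + `|W i (z + 1)|).
have [d2 d20 Hd2] : exists2 d : R, 0 < d &
    forall z, a <= z <= b -> d * size z <= 2^-1.
  by apply: exists_small_factor => z _; left.
pose d := Num.min d1 d2.
have d0 : 0 < d by rewrite lt_min d10.
exists d, (fun i => pl_interp (W i)); split=> // [i|c Hc|e ed].
- by apply: continuous_subspaceT => x; exact: pl_interp_continuous.
- apply: Wfree => z zab.
  rewrite -[RHS](Hc z%:~R).
    by apply: eq_bigr => i _; rewrite pl_interp_int.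
  by rewrite /= /pl_ext !ler_int zab ltry.
pose w z := \sum_(i < k) e i * W i z.
have -> : (fun x => fine (expeR (- pl_ext a b V x)%E) *
      (1 + \sum_(i < k) e i * pl_interp (W i) x)) =
    (fun x => fine (expeR (- pl_ext a b V x)%E) * (1 + pl_interp w x)).
  by apply/funext => x; rewrite -(piece_sum e W (Num.floor x)).
have w_small z x : piece_index a b z -> a%:~R <= x <= b%:~R ->
    2^-1 <= 1 + piece w z x.
  move=> zI xab; have zab : a <= z <= b by move: zI; rewrite /piece_index; lia.
  suff : `|piece w z x| <= 2^-1 by rewrite ler_norml; lra.
  rewrite piece_sum (le_trans (normr_sum_coef_le _ ed))//.
  apply: le_trans (Hd2 z zab).
  apply: ler_pM; rewrite ?(ltW d0) ?sumr_ge0// ?ge_min ?lexx ?orbT//.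
  by apply: ler_sum => i _; exact: piece_norm_le.
have w_curv z : a < z < b -> 2 * `|second_diff w z| <= second_diff V z.
  move=> zab; apply: (le_trans _ (Hd1 z _)); last by lia.
  rewrite second_diff_sum mulrCA ler_pM2l//.
  rewrite (le_trans (normr_sum_coef_le _ ed))//.
  by rewrite ler_wpM2r ?sumr_ge0// ge_min lexx.
apply: log_concave_on_segment => [x xab|x y t xab yab t01].
  have [z zI zx] := piece_indexP ab xab.
  by rewrite (pl_interp_piece _ zx); have := w_small z x zI xab; lra.
exact: (pl_potential_convex w_small w_curv).
Qed.

(** * From continuous to discrete perturbations *)

(** The same cancellation as in the discrete case, for any weight [t]: the equality on [V] removes
    the exponentials from the log-concavity inequality. *)
Lemma cdof_affine (R : realType) (a b : int) (V : int -> R) (k : nat)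
    (alpha t x y : R) (W : 'I_k -> R -> R) (j : 'I_k) :
  0 < alpha ->
  (forall e : 'I_k -> R, (forall i, - alpha <= e i <= alpha) ->
    log_concave (fun x => fine (expeR (- pl_ext a b V x)%E) *
                      (1 + \sum_(i < k) e i * W i x))) ->
  a%:~R <= x <= b%:~R -> a%:~R <= y <= b%:~R -> 0 <= t <= 1 ->
  pl_interp V (t * x + (1 - t) * y) =
    t * pl_interp V x + (1 - t) * pl_interp V y ->
  W j (t * x + (1 - t) * y) = t * W j x + (1 - t) * W j y.
Proof.
move=> alpha0 H xab yab t01 Vt; set m := t * x + _.
have mab : a%:~R <= m <= b%:~R by rewrite /m; nra.
apply: (ln_first_order alpha0 t01) => e eB u0 v0 m0.
have [] := log_concave_ln (x := x) (y := y)
  (H _ (fun i => single_bound j i eB)) t01.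
- by rewrite /pl_ext xab /= sum_single mulr_gt0 ?expR_gt0.
- by rewrite /pl_ext yab /= sum_single mulr_gt0 ?expR_gt0.
move=> _; rewrite /pl_ext -/m xab yab mab /= !sum_single !ln_expRM//.
by rewrite /m Vt; lra.
Qed.

Lemma cdof_ddof (R : realType) (a b : int) (V : int -> R) (k : nat) :
  dconvex a b V -> cdof_family (pl_ext a b V) k -> ddof_family a b V k.
Proof.
move=> hV [alpha [W [alpha0 _ Wfree H]]].
(* This bound keeps [1 + \sum_(i < k) e i * W i z] at least 1/2 at the integers, so real logarithms
   can be used. *)
have [d1 d10 Hd1] : exists2 d : R, 0 < d & forall z, a <= z <= b ->
    d * (\sum_(i < k) `|W i z%:~R|) <= 2^-1.
  by apply: exists_small_factor => z _; left.
pose d := Num.min alpha d1.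
have d0 : 0 < d by rewrite lt_min alpha0.
exists d, (fun i z => W i z%:~R); split=> // [c Hc|e ed].
  (* A linear relation at the integers extends to every [x] in [a, b], because each [W i] is affine
     between consecutive integers. *)
  apply: Wfree => x; rewrite /= /pl_ext; case: ifP => // xab _.
  set z := Num.floor x.
  have [zx xz] : z%:~R <= x /\ x < (z + 1)%:~R.
    by split; rewrite ?floor_le_tmp ?floorD1_gt.
  have az : a <= z by rewrite floor_ge_int_tmp; case/andP: xab.
  have zb : z <= b by rewrite -(ler_int R) (le_trans zx)//; case/andP: xab.
  have [zE|zNx] := eqVneq z%:~R x.
    by rewrite -[RHS](Hc z _) ?zE//=; lia.
  have zb' : z + 1 <= b.
    rewrite lezD1 -(ltr_int R) (lt_le_trans _ (proj2 (andP xab)))//.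
    by rewrite lt_neqAle zNx.
  pose t := (z + 1)%:~R - x.
  have z1 : (z + 1)%:~R = z%:~R + 1 :> R by rewrite rmorphD.
  have xE : x = t * z%:~R + (1 - t) * (z + 1)%:~R by rewrite /t z1; ring.
  have xW i : W i x = t * W i z%:~R + (1 - t) * W i (z + 1)%:~R.
    rewrite {1}xE; apply: (cdof_affine i alpha0 H).
    - by rewrite !ler_int; lia.
    - by rewrite !ler_int; lia.
    - by rewrite /t z1; lra.
    - have zI : z%:~R <= x <= (z + 1)%:~R by rewrite zx ltW.
      by rewrite -xE (pl_interp_piece _ zI) !pl_interp_int /piece /t z1; ring.
  under eq_bigr => i _ do rewrite xW mulrDr !(mulrCA (c i)).
  by rewrite big_split -!mulr_sumr !Hc ?mulr0 /= ?addr0//; lia.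

have ea i : - alpha <= e i <= alpha.
  by have := ed i; have : d <= alpha by [rewrite ge_min lexx|]; lra.
have g0 z : a <= z <= b -> 0 < 1 + \sum_(i < k) e i * W i z%:~R.
  move=> zab; suff : `|\sum_(i < k) e i * W i z%:~R| <= 2^-1.
    by rewrite ler_norml; lra.
  rewrite (le_trans (normr_sum_coef_le _ ed))// (le_trans _ (Hd1 z zab))//.
  by rewrite ler_wpM2r ?sumr_ge0// ge_min lexx orbT.
apply: dlog_concave_gt0 => [z zab|z zab].
  by rewrite mulr_gt0 ?expR_gt0 ?g0.
have fE n : a <= n <= b -> expR (- V n) * (1 + \sum_(i < k) e i * W i n%:~R) =
    fine (expeR (- pl_ext a b V n%:~R)%E) * (1 + \sum_(i < k) e i * W i n%:~R).
  by move=> nab; rewrite /pl_ext !ler_int nab /= pl_interp_int.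
(* The discrete inequality at [z] is continuous log-concavity at the midpoint of [z - 1] and
   [z + 1]. *)
have [|||_] := log_concave_ln (x := (z - 1)%:~R) (y := (z + 1)%:~R)
  (t := 2^-1) (H e ea); first by lra.
- by rewrite -fE ?mulr_gt0 ?expR_gt0 ?g0//; lia.
- by rewrite -fE ?mulr_gt0 ?expR_gt0 ?g0//; lia.
have -> : 2^-1 * (z - 1)%:~R + (1 - 2^-1) * (z + 1)%:~R = z%:~R :> R.
  by rewrite rmorphB rmorphD /=; field.
by rewrite -!fE; [lra | lia..].
Qed.

(** * Existence of the largest dimension *)

(** Independence makes the matrix of values at the integer points row-free, so its row count is at
    most its column count. *)
Lemma ddof_family_bounded (R : realType) (a b : int) (V : int -> R) (k : nat) :
  ddof_family a b V k -> (k <= `|b - a|.+1)%N.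
Proof.
move=> [alpha [W [_ Wfree _]]].
pose M := \matrix_(i < k, n < `|b - a|.+1) W i (a + n%:Z).
suff /eqP <- : row_free M by exact: rank_leq_col.
rewrite -kermx_eq0; apply/rowV0P => v /sub_kermxP vM.
apply/rowP => i; rewrite mxE; apply: (Wfree (v 0)) => z zab.
have zn : (`|z - a| < `|b - a|.+1)%N by move: zab; rewrite /=; lia.
have := congr1 (fun A : 'rV_ _ => A 0 (Ordinal zn)) vM.
rewrite !mxE => vM0; rewrite -{}[RHS]vM0; apply: eq_bigr => j _.
by rewrite mxE /=; congr (_ * W _ _); move: zab => /=; lia.
Qed.

Lemma ddof_family0 (R : realType) (a b : int) (V : int -> R) :
  dconvex a b V -> ddof_family a b V 0.
Proof.
move=> hV; exists 1, (fun _ _ => 0); split=> [||e _]; first exact: ltr01.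
  by move=> c _ [].
apply: dlog_concave_gt0 => [z _|z zab].
  by rewrite big_ord0 addr0 mulr1 expR_gt0.
by rewrite !big_ord0 !addr0 !mulr1 !expRK; have := hV z zab; lra.
Qed.

Lemma largest_exists (P : nat -> Prop) (m : nat) : P 0 ->
  (forall k, P k -> (k <= m)%N) -> exists k, largest P k.
Proof.
move=> P0 Pm.
have exP : exists k, `[< P k >] by exists 0; apply/asboolP.
have ubP k : `[< P k >] -> (k <= m)%N by move=> /asboolP/Pm.
case: (ex_maxnP exP ubP) => k /asboolP Pk kmax.
by exists k; split=> // j Pj; apply: kmax; apply/asboolP.
Qed.

Theorem lemma2p1 (R : realType) (a b : int) (hab : a <= b)
    (V : int -> R) (hV : dconvex a b V) :
  exists k : nat, is_ddof a b V k /\ is_cdof (pl_ext a b V) k.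
Proof.
(* The maximum is taken on the discrete side, where the dimension is visibly bounded; the two
   transfers then make it the continuous maximum as well. *)
have [k [dk kmax]] := largest_exists (ddof_family0 hV)
  (@ddof_family_bounded R a b V).
exists k; split; split=> //; first exact: ddof_cdof.
by move=> j /(cdof_ddof hV)/kmax.
Qed.
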